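(* Let $G$ be a finitely generated abelian group, $G\cong\mathbb{Z}^m\oplus\bigoplus_{i=1}^l\mathbb{Z}_{q_i}$, and let $S$ be a finite symmetric generating set of $G$ ($S=-S$). Then there exist constants $C_1$ and $C_2$ depending only on $m$ and $S$ such that for any $x\in G$, any real $R\geq 1$ and any positive function $f:\overline{B_{C_1R}(x)}\to\mathbb{R}$ that is discrete harmonic on $B_{C_1R}(x)$, we have $$|\nabla f|(x)\leq \frac{C_2}{R}f(x).$$
   Context: Group: $m\ge 1$ and $l\ge 0$ are integers ($l=0$ being the torsion-free case), and each $q_i=p_i^{a_i}$ is a prime power. Generating sets: a finite symmetric generating set is a finite list $S=(s_1,\dots,s_{2r})$ of elements generating $G$ with $s_{i+r}=-s_i$ for $1\le i\le r$; repetitions are allowed and $0\in S$ is allowed. The Cayley graph $(G,S)$ has vertex set $G$, and $x\sim y$ iff $y-x\in S$ (repeated elements give multi-edges, $0$ gives self-loops). Sums over $y\sim x$ are taken with multiplicity, i.e. $\sum_{y\sim x}h(y)=\sum_{i=1}^{2r}h(x+s_i)$. Metric: $d^S(x,y)$ is the length of a shortest path from $x$ to $y$ in $(G,S)$ (word metric), and $B_r(x)=\{y\in G: d^S(x,y)\le r\}$. For $\Omega\subset G$, $\partial\Omega=\{z\in G: d^S(z,\Omega)=1\}$ and $\overline\Omega=\Omega\cup\partial\Omega$. Operators: for $f:\overline\Omega\to\mathbb{R}$ and $x\in\Omega$, $L^Sf(x)=\sum_{y\sim x}(f(y)-f(x))$ and $|\nabla f|(x)=\sqrt{\sum_{y\sim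 x}(f(y)-f(x))^2}$. The function $f$ is discrete harmonic on $\Omega$ if $L^Sf(x)=0$ for all $x\in\Omega$. *)

(* Defs.v *)
From HB Require Import structures.
From mathcomp Require Import all_boot all_order all_algebra.
From mathcomp Require Import all_classical all_reals ereal.

Set Implicit Arguments.
Unset Strict Implicit.
Unset Printing Implicit Defensive.

Import Order.TTheory GRing.Theory Num.Theory.
Local Open Scope classical_set_scope.
Local Open Scope ring_scope.

(* MathComp has the pointwise group structure on {ffun I -> M} but not on
   dependent finite products, which are needed for a sum of the Z/q_i. *)
Section DependentProduct.
Variables (I : finType) (M : I -> zmodType).
Implicit Types x y z : {dffun forall i : I, M i}.

Definition dprod_zero : {dffun forall i : I, M i} := [ffun i => 0 : M i].
Definition dprod_opp x : {dffun forall i : I, M i} := [ffun i => - x i].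
Definition dprod_add x y : {dffun forall i : I, M i} := [ffun i => x i + y i].

Fact dprod_addA : associative dprod_add.
Proof. by move=> x y z; apply/ffunP => i; rewrite !ffunE addrA. Qed.
Fact dprod_addC : commutative dprod_add.
Proof. by move=> x y; apply/ffunP => i; rewrite !ffunE addrC. Qed.
Fact dprod_add0 : left_id dprod_zero dprod_add.
Proof. by move=> x; apply/ffunP => i; rewrite !ffunE add0r. Qed.
Fact dprod_addN : left_inverse dprod_zero dprod_opp dprod_add.
Proof. by move=> x; apply/ffunP => i; rewrite !ffunE addNr. Qed.

HB.instance Definition _ := GRing.isNmodule.Build {dffun forall i : I, M i}
  dprod_addA dprod_addC dprod_add0.
HB.instance Definition _ :=
  GRing.Nmodule_isZmodule.Build {dffun forall i : I, M i} dprod_addN.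
End DependentProduct.

Definition zmod_isom (G H : zmodType) : Prop :=
  exists phi : {additive G -> H}, bijective phi.

(* 'Z_n is the ring of integers mod n only for 1 < n. *)
Definition fg_abelian_model (m l : nat) (q : 'I_l -> nat) : zmodType :=
  ('rV[int]_m * {dffun forall i : 'I_l, 'Z_(q i)})%type.

Section CayleyGraph.
Variable G : zmodType.

Definition generates (S : seq G) : Prop :=
  forall H : {pred G}, GRing.zmod_closed H -> {subset S <= H} -> H =i predT.

Definition symmetric_generating_list (r : nat) (S : (r + r).-tuple G) : Prop :=
  (forall i : 'I_r, tnth S (rshift r i) = - tnth S (lshift r i)) /\ generates S.

Definition cayley_adj (S : seq G) : rel G := fun x y => y - x \in S.

Variable R : realType.
Implicit Types (S : seq G) (x y z : G) (Om : set G) (f : G -> R).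

(* Extended-real valued, so that the infimum over no path at all is +oo. *)
Definition word_dist S x y : \bar R :=
  ereal_inf [set (size p)%:R%:E | p in
    [set p : seq G | path (cayley_adj S) x p /\ last x p = y]].

Definition word_ball S x (rho : R) : set G :=
  [set y | (word_dist S x y <= rho%:E)%E].

Definition set_dist S z Om : \bar R :=
  ereal_inf [set word_dist S z w | w in Om].

Definition vertex_boundary S Om : set G := [set z | set_dist S z Om = 1%E].

Definition vertex_closure S Om : set G := Om `|` vertex_boundary S Om.

(* Sums over the neighbours y = x + s run over the list S, so they count
   repeated generators with multiplicity. *)
Definition laplacian S f x : R := \sum_(s <- S) (f (x + s) - f x).

Definition grad_norm S f x : R :=
  Num.sqrt (\sum_(s <- S) (f (x + s) - f x) ^+ 2).

Definition harmonic_on S f Om : Prop := forall x, Om x -> laplacian S f x = 0.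

End CayleyGraph.

(* Main.v *)
Require Import Defs.
From mathcomp Require Import all_boot all_order all_algebra.
From mathcomp Require Import all_classical all_reals ereal.
From mathcomp Require Import ring lra.

Set Implicit Arguments.
Unset Strict Implicit.
Unset Printing Implicit Defensive.

Import Order.TTheory GRing.Theory Num.Theory.
Local Open Scope ring_scope.

(** Bernstein-type argument: put g = sqrt f and F = - (Laplacian g) / g.
    Harmonicity of f gives F = |grad g|^2 / (2 g^2), and, as translations
    commute, the Bochner-type inequality
      sum_t g(x+t)^2 F(x+t) - |S| g(x)^2 F(x) >= c g(x)^2 F(x)^2,
    which is Cauchy-Schwarz with its deficit.  At a maximum point of eta^2 F,
    where eta = 1 - |pi|^2 / rho^2 is built from the projection pi onto the
    free part, this forces eta^2 F = O(1 / rho^2): eta has first differences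
    O(1 / rho), and the sum of its differences over S is -O(1 / rho^2) because
    S is symmetric.  The set eta > 0 lies in a word ball of radius O(rho), since
    the torsion part is finite. *)
Section GradientEstimate.
Variables (R : realType) (G : zmodType) (S : seq G).
Hypothesis S_sym : perm_eq [seq - s | s <- S] S.

(** * Sums over a symmetric list *)

Lemma mem_opp_sym s : s \in S -> - s \in S.
Proof. by move=> sS; rewrite -(perm_mem S_sym); apply: map_f. Qed.

Lemma sum_opp_sym (V : nmodType) (h : G -> V) :
  \sum_(s <- S) h (- s) = \sum_(s <- S) h s.
Proof. by rewrite -[RHS](perm_big _ S_sym) big_map. Qed.

Lemma sum_additive_sym (h : G -> R) : {morph h : x y / x + y} ->
  \sum_(s <- S) h s = 0.
Proof.
move=> hD.
have h0 : h 0 = 0 by apply: (addrI (h 0)); rewrite -hD !addr0.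
have hN s : h (- s) = - h s.
  by apply: (addrI (h s)); rewrite -hD !subrr.
have := sum_opp_sym h; under eq_bigr do rewrite hN.
rewrite sumrN => /eqP; rewrite eq_sym -subr_eq0 opprK -mulr2n mulrn_eq0 /=.
by move/eqP.
Qed.

Local Notation D := ((size S)%:R : R).
(** [E] serves as a bound in place of the square root of [D], and as a denominator that is nonzero
    even for empty [S]. *)
Local Notation E := (D + 1).

Lemma sum_cst (c : R) : \sum_(s <- S) c = D * c.
Proof. by rewrite big_const_seq count_predT iter_addr_0 mulr_natl. Qed.

Lemma ge_sum_term (h : G -> R) s : (forall t, 0 <= h t) -> s \in S ->
  h s <= \sum_(t <- S) h t.
Proof.
move=> h0 sS; rewrite (big_rem s) //= lerDl.
by apply: sumr_ge0.
Qed.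

(* For g = sqrt f with f harmonic this equals |grad g|^2 / (2 g^2): see
   sqr_harmonic_energy. *)
Definition defect (g : G -> R) (x : G) : R :=
  \sum_(s <- S) (1 - g (x + s) / g x).

Definition sqr_harmonic (g : G -> R) (x : G) : Prop :=
  \sum_(s <- S) g (x + s) ^+ 2 = D * g x ^+ 2.

(** * Pointwise bounds and the Bochner inequality *)

Section Pointwise.
Variables (g : G -> R) (x : G).
Hypotheses (gx : 0 < g x) (hx : sqr_harmonic g x).

Lemma sqr_harmonic_ratio : \sum_(s <- S) (g (x + s) / g x) ^+ 2 = D.
Proof.
under eq_bigr do rewrite expr_div_n.
by rewrite -mulr_suml hx mulfK // expf_neq0 ?gt_eqF.
Qed.

(** For each ratio u, (u - 1)^2 = 2 (1 - u) + (u^2 - 1), and the terms u^2 - 1 sum to zero by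
    harmonicity. *)
Lemma sqr_harmonic_energy :
  \sum_(s <- S) (g (x + s) / g x - 1) ^+ 2 = 2 * defect g x.
Proof.
transitivity (\sum_(s <- S) (2 * (1 - g (x + s) / g x) +
   ((g (x + s) / g x) ^+ 2 - 1))).
  by apply: eq_bigr => s _; ring.
rewrite big_split /= -mulr_sumr -/(defect g x) sumrB sqr_harmonic_ratio.
by rewrite sum_cst mulr1 subrr addr0.
Qed.

Lemma defect_ge0 : 0 <= defect g x.
Proof.
suff : 0 <= 2 * defect g x by rewrite pmulr_rge0.
by rewrite -sqr_harmonic_energy; apply: sumr_ge0 => s _; apply: sqr_ge0.
Qed.

Lemma sqr_harmonic_ratio_le s : s \in S -> g (x + s) / g x <= E.
Proof.
move=> sS; have D0 : 0 <= D by [].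
have : (g (x + s) / g x) ^+ 2 <= D.
  rewrite -sqr_harmonic_ratio.
  by apply: (@ge_sum_term (fun s => (g (x + s) / g x) ^+ 2)) => // t; apply: sqr_ge0.
move=> h; have : (g (x + s) / g x) ^+ 2 <= E ^+ 2 by nra.
move=> h2; have [r0|r0] := lerP (g (x + s) / g x) 0; first by lra.
by rewrite -(@ler_pXn2r _ 2) // nnegrE; lra.
Qed.

Lemma ratio_sub1_le s : s \in S -> (g (x + s) / g x - 1) ^+ 2 <= 2 * defect g x.
Proof.
move=> sS; rewrite -sqr_harmonic_energy.
by apply: (@ge_sum_term (fun s => (g (x + s) / g x - 1) ^+ 2)) => // t;
  apply: sqr_ge0.
Qed.

Hypotheses (gxs : forall s, s \in S -> 0 < g (x + s))
           (hxs : forall s, s \in S -> sqr_harmonic g (x + s)).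

Lemma defect_le : defect g x <= D.
Proof.
rewrite -[leRHS]mulr1 -sum_cst /defect !big_seq; apply: ler_sum => s sS.
by rewrite lerBlDr lerDl divr_ge0 // ltW // gxs.
Qed.

(* The quantitative form of Cauchy-Schwarz between t |-> g (x + t) and
   t |-> g (x + s + t); of its deficit only the term t = - s is kept. *)
Lemma corr_le s : s \in S ->
  \sum_(t <- S) g (x + t) * g (x + s + t) <=
  D * (g x * g (x + s)) -
  g x ^+ 2 * ((1 - (g (x + s) / g x) * (g (x - s) / g x)) ^+ 2 / (2 * E)).
Proof.
move=> sS; have D0 : 0 <= D by [].
set a := g x; set b := g (x + s).
have a0 : 0 < a := gx; have b0 : 0 < b by apply: gxs.
have rE : b / a <= E by apply: sqr_harmonic_ratio_le.
(* Expanding the squares gives the identity: the square sums around [x] and [x + s] are [D * a ^+ 2]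
   and [D * b ^+ 2]. *)
have deficit : D * (a * b) - \sum_(t <- S) g (x + t) * g (x + s + t) =
    (\sum_(t <- S) (b * g (x + t) - a * g (x + s + t)) ^+ 2) / (2 * (a * b)).
  have -> : \sum_(t <- S) (b * g (x + t) - a * g (x + s + t)) ^+ 2 =
    2 * (a * b) * (D * (a * b) - \sum_(t <- S) g (x + t) * g (x + s + t)).
    transitivity (\sum_(t <- S) (b ^+ 2 * g (x + t) ^+ 2 +
       a ^+ 2 * g (x + s + t) ^+ 2 - 2 * (a * b) * (g (x + t) * g (x + s + t)))).
      by apply: eq_bigr => t _; ring.
    rewrite sumrB big_split /= -!mulr_sumr hx (hxs sS) -/a -/b; ring.
  by rewrite mulrAC mulfV ?mul1r // gt_eqF //; nra.
have key : (b * g (x - s) - a * a) ^+ 2 <=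
    \sum_(t <- S) (b * g (x + t) - a * g (x + s + t)) ^+ 2.
  have /= := @ge_sum_term (fun t => (b * g (x + t) - a * g (x + s + t)) ^+ 2)
    (- s) (fun t => sqr_ge0 _) (mem_opp_sym sS).
  by rewrite addrK.
suff : a ^+ 2 * ((1 - (b / a) * (g (x - s) / a)) ^+ 2 / (2 * E)) <=
    (b * g (x - s) - a * a) ^+ 2 / (2 * (a * b)).
  move=> h1; have h2 : (b * g (x - s) - a * a) ^+ 2 / (2 * (a * b)) <=
    D * (a * b) - \sum_(t <- S) g (x + t) * g (x + s + t).
    by rewrite deficit ler_pM2r // invr_gt0; nra.
  lra.
(* With a common numerator, only the denominators remain to be compared, through [b <= E * a]. *)
have -> : a ^+ 2 * ((1 - (b / a) * (g (x - s) / a)) ^+ 2 / (2 * E)) =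
   (b * g (x - s) - a * a) ^+ 2 * (a ^+ 2 * E * 2)^-1.
  by field; rewrite !gt_eqF //; lra.
apply: ler_wpM2l; first exact: sqr_ge0.
rewrite lef_pV2 ?posrE; last by nra.
- have : b <= E * a by rewrite -ler_pdivrMr.
  by nra.
- by rewrite !mulr_gt0 ?exprn_gt0 //; lra.
Qed.

(* Linearising the square at lambda replaces a second use of
   Cauchy-Schwarz. *)
Lemma midpoint_deficit (r1 r2 lambda : R) : 0 < r1 -> 0 < r2 -> 0 <= lambda ->
  2 * lambda * (1 - (r1 + r2) / 2) - lambda ^+ 2 <= (1 - r1 * r2) ^+ 2.
Proof.
move=> r10 r20 l0; set d := 1 - (r1 + r2) / 2.
have [d0|d0] := lerP d 0; first by have := sqr_ge0 (1 - r1 * r2); nra.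
(* AM-GM. Hence 1 - r1 r2 is at least 2 d - d^2, which is at least [d] for 0 < d < 1. *)
have dr : r1 * r2 <= (1 - d) ^+ 2 by rewrite /d; have := sqr_ge0 (r1 - r2); nra.
have d1 : d < 1 by rewrite /d; lra.
have h1 : d <= 1 - r1 * r2 by nra.
have := sqr_ge0 (d - lambda); nra.
Qed.

(** Since x + t + s = x + s + t, the right side is a constant minus the correlations bounded in
    [corr_le]. The deficits, linearised by [midpoint_deficit], add up to the term quadratic in the
    defect. *)
Lemma defect_bochner :
  D * (g x ^+ 2 * defect g x) + g x ^+ 2 * (defect g x ^+ 2 / (2 * E ^+ 2)) <=
  \sum_(t <- S) g (x + t) ^+ 2 * defect g (x + t).
Proof.
have D0 : 0 <= D by [].
set a := g x; set F := defect g x; have a0 : 0 < a := gx.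
have F0 : 0 <= F := defect_ge0.
have -> : \sum_(t <- S) g (x + t) ^+ 2 * defect g (x + t) =
    D * (D * a ^+ 2) - \sum_(s <- S) \sum_(t <- S) g (x + t) * g (x + s + t).
  rewrite [in RHS]exchange_big /= -hx mulr_sumr -sumrB.
  rewrite !big_seq; apply: eq_bigr => t tS.
  rewrite /defect mulr_sumr -sum_cst -sumrB; apply: eq_bigr => s _.
  by rewrite mulrBr mulr1 (addrAC x) expr2; congr (_ - _); field; rewrite gt_eqF // gxs.
(* The expression [2 * lambda * F - D * lambda ^+ 2] is largest at [F / D]; [F / E] avoids a zero
   denominator and still leaves at least [F ^+ 2 / E]. *)
set lambda := F / E.
have l0 : 0 <= lambda by rewrite divr_ge0 //; lra.
have Fsym : \sum_(s <- S) (1 - (g (x + s) / a + g (x - s) / a) / 2) = F.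
  transitivity (\sum_(s <- S) (2^-1 * (1 - g (x + s) / a) + 2^-1 * (1 - g (x - s) / a))).
    by apply: eq_bigr => s _; lra.
  rewrite big_split /= -!mulr_sumr (sum_opp_sym (fun s => 1 - g (x + s) / a)).
  by rewrite -/(defect g x) -/F; lra.
have Fdef : \sum_(s <- S) a * g (x + s) = D * a ^+ 2 - a ^+ 2 * F.
  rewrite /F /defect mulr_sumr -sum_cst -sumrB; apply: eq_bigr => s _.
  by rewrite -/a; field; rewrite gt_eqF.
have : \sum_(s <- S) \sum_(t <- S) g (x + t) * g (x + s + t) <=
   \sum_(s <- S) (D * (a * g (x + s)) - a ^+ 2 / (2 * E) *
     (2 * lambda * (1 - (g (x + s) / a + g (x - s) / a) / 2) - lambda ^+ 2)).
  rewrite !big_seq; apply: ler_sum => s sS; apply: le_trans (corr_le sS) _.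
  rewrite lerD2l lerN2 -/a [leRHS]mulrCA [leLHS]mulrC.
  apply: ler_wpM2r; first by rewrite divr_ge0 ?sqr_ge0 //; lra.
  by apply: midpoint_deficit => //; apply: divr_gt0 => //; apply: gxs => //;
    apply: mem_opp_sym.
rewrite sumrB -mulr_sumr Fdef -mulr_sumr sumrB -mulr_sumr Fsym sum_cst => h.
have : F ^+ 2 / E <= 2 * lambda * F - D * lambda ^+ 2.
  have -> : 2 * lambda * F - D * lambda ^+ 2 = F ^+ 2 / E + F ^+ 2 / E ^+ 2.
    by rewrite /lambda; field; rewrite gt_eqF //; lra.
  by rewrite lerDl divr_ge0 // sqr_ge0.
move=> h2.
have h3 : a ^+ 2 / (2 * E) * (F ^+ 2 / E) <= a ^+ 2 / (2 * E) * (2 * lambda * F - D * lambda ^+ 2).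
  by apply: ler_wpM2l => //; rewrite divr_ge0 ?sqr_ge0 //; lra.
have -> : a ^+ 2 * (F ^+ 2 / (2 * E ^+ 2)) = a ^+ 2 / (2 * E) * (F ^+ 2 / E).
  by field; rewrite gt_eqF //; lra.
lra.
Qed.

End Pointwise.

(** * The cutoff function and the estimate at a maximum point *)

Section Cutoff.
Variables (m : nat) (pi : 'I_m -> G -> R).
Hypothesis piD : forall i, {morph pi i : x y / x + y}.

Definition cutoff (rho : R) (x : G) : R := 1 - (\sum_i pi i x ^+ 2) / rho ^+ 2.

Definition cutoff_lap_const : R := \sum_(s <- S) \sum_i pi i s ^+ 2.

Definition cutoff_lip_const : R :=
  \sum_(s <- S) \sum_i (2 * `|pi i s| + pi i s ^+ 2).

Lemma cutoff_le1 rho x : cutoff rho x <= 1.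
Proof.
rewrite lerBlDr lerDl divr_ge0 ?sqr_ge0 //.
by apply: sumr_ge0 => i _; apply: sqr_ge0.
Qed.

Lemma cutoffD rho x t : cutoff rho (x + t) =
  cutoff rho x - (\sum_i (2 * pi i x * pi i t + pi i t ^+ 2)) / rho ^+ 2.
Proof.
rewrite /cutoff -addrA -opprD -mulrDl -big_split /=; congr (1 - _ / _).
by apply: eq_bigr => i _; rewrite piD; ring.
Qed.

(** The terms linear in [t] cancel by symmetry; only the squares [pi i t ^+ 2] survive, whence the
    order 1 / rho^2. *)
Lemma cutoff_lap rho x :
  \sum_(t <- S) (cutoff rho x - cutoff rho (x + t)) = cutoff_lap_const / rho ^+ 2.
Proof.
under eq_bigr do rewrite cutoffD subKr big_split /=.
rewrite -mulr_suml big_split /= exchange_big /= big1 ?add0r // => i _.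
by rewrite -mulr_sumr sum_additive_sym ?mulr0 //; apply: piD.
Qed.

Lemma cutoff_gt0_coord rho x i : 0 < rho -> 0 < cutoff rho x ->
  `|pi i x| <= rho.
Proof.
move=> rho0; rewrite subr_gt0 ltr_pdivrMr ?exprn_gt0 // mul1r => h.
rewrite -(@ler_pXn2r _ 2) ?nnegrE ?normr_ge0 ?(ltW rho0) //.
rewrite real_normK ?num_real //; apply: le_trans (ltW h).
rewrite (bigD1 i) //= lerDl; apply: sumr_ge0 => j _; exact: sqr_ge0.
Qed.

(** Where the cutoff is positive, [pi i x] is at most [rho] in absolute value, so the cross terms
    are O(rho); [1 <= rho] absorbs the squares. *)
Lemma cutoff_lip rho x t : 1 <= rho -> 0 < cutoff rho x -> t \in S ->
  `|cutoff rho x - cutoff rho (x + t)| <= cutoff_lip_const / rho.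
Proof.
move=> rho1 cx tS; have rho0 : 0 < rho by lra.
rewrite cutoffD subKr normrM normfV (ger0_norm (sqr_ge0 _)).
rewrite ler_pdivrMr ?exprn_gt0 // expr2 mulrA divfK ?gt_eqF //.
apply: (@le_trans _ _ (rho * \sum_i (2 * `|pi i t| + pi i t ^+ 2))).
  apply: le_trans (ler_norm_sum _ _ _) _; rewrite mulr_sumr.
  apply: ler_sum => i _; apply: le_trans (ler_normD _ _) _.
  rewrite (ger0_norm (sqr_ge0 _)) !normrM normr_nat.
  have := cutoff_gt0_coord i rho0 cx; have := normr_ge0 (pi i t).
  have := sqr_ge0 (pi i t); nra.
rewrite mulrC ler_pM2r //.
apply: (@ge_sum_term (fun t => \sum_i (2 * `|pi i t| + pi i t ^+ 2))) => // s.
by apply: sumr_ge0 => i _; rewrite addr_ge0 ?sqr_ge0 ?mulr_ge0.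
Qed.

Lemma cutoff_lip_const_ge0 : 0 <= cutoff_lip_const.
Proof.
apply: sumr_ge0 => s _; apply: sumr_ge0 => i _.
by rewrite addr_ge0 ?sqr_ge0 ?mulr_ge0.
Qed.

Lemma cutoff_lap_const_ge0 : 0 <= cutoff_lap_const.
Proof. by apply: sumr_ge0 => s _; apply: sumr_ge0 => i _; apply: sqr_ge0. Qed.

(* With p = h / k and d = h - k one has h (p - 1) = d p, hence
   h^2 (p^2 - 1) = 2 h d + d^2 p (p + 2). *)
Lemma cutoff_ratio (h k r w F Fk delta : R) :
  0 < h -> `|h - k| <= delta -> 2 * delta <= h ->
  0 < r -> r <= E -> 0 <= w -> (r - 1) ^+ 2 <= w ^+ 2 ->
  0 <= F -> k ^+ 2 * Fk <= h ^+ 2 * F ->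
  h ^+ 2 * (r ^+ 2 * Fk) <= h ^+ 2 * (r ^+ 2 * F) +
    F * (2 * h * (h - k) + 8 * delta ^+ 2 + 6 * (E + 1) * (w * h) * delta).
Proof.
move=> h0 /[dup] hk; rewrite ler_norml => /andP[hk1 hk2] dh r0 rE w0 rw F0 FkF.
have D0 : 0 <= D by [].
have d0 : 0 <= delta by apply: le_trans hk.
have k0 : 0 < k by lra.
set d := h - k; set p := h / k.
have p0 : 0 < p by apply: divr_gt0.
have p2 : p <= 2 by rewrite ler_pdivrMr //; lra.
have pk : p * k = h by rewrite divfK ?gt_eqF.
have hp : h * (p - 1) = d * p by rewrite /d -pk; ring.
have hpp : h ^+ 2 * (p ^+ 2 - 1) = h * d * (p * (p + 1)).
  by have -> : h ^+ 2 * (p ^+ 2 - 1) = h * (h * (p - 1)) * (p + 1); [ring|rewrite hp; ring].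
have hpp2 : h ^+ 2 * (p ^+ 2 - 1) = 2 * h * d + d ^+ 2 * (p * (p + 2)).
  rewrite hpp; have -> : h * d * (p * (p + 1)) = 2 * h * d + d * (h * (p - 1)) * (p + 2) by ring.
  by rewrite hp; ring.
have dd : d ^+ 2 <= delta ^+ 2 by rewrite -[d ^+ 2]real_normK ?num_real // ler_sqr ?nnegrE.
(* For [p <= 2], the numbers 8 here and 6 below bound p (p + 2) and p (p + 1). *)
have h1 : h ^+ 2 * (p ^+ 2 - 1) <= 2 * h * d + 8 * delta ^+ 2.
  rewrite hpp2 lerD2l mulrC; apply: ler_pM => //; first by nra.
    exact: sqr_ge0.
  by nra.
have h2 : `|h ^+ 2 * (p ^+ 2 - 1)| <= 6 * (h * delta).
  rewrite hpp normrM mulrC (gtr0_norm (mulr_gt0 _ _)) //; last by lra.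
  apply: ler_pM => //; first by nra.
    by nra.
  by rewrite normrM (gtr0_norm h0) ler_pM2l.
have h3 : `|r ^+ 2 - 1| <= w * (E + 1).
  have -> : r ^+ 2 - 1 = (r - 1) * (r + 1) by ring.
  rewrite normrM (gtr0_norm (_ : 0 < r + 1)); last by lra.
  apply: ler_pM => //; [by lra| |by lra].
  by rewrite -(@ler_pXn2r _ 2) ?nnegrE // real_normK ?num_real.
have h4 : (r ^+ 2 - 1) * (h ^+ 2 * (p ^+ 2 - 1)) <= w * (E + 1) * (6 * (h * delta)).
  by apply: le_trans (ler_norm _) _; rewrite normrM; apply: ler_pM.
(* Split r^2 = 1 + (r^2 - 1): [h1] bounds the first part and [h4] the second. *)
have h5 : r ^+ 2 * (h ^+ 2 * (p ^+ 2 - 1)) <=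
    2 * h * d + 8 * delta ^+ 2 + 6 * (E + 1) * (w * h) * delta by lra.
have h6 : Fk <= p ^+ 2 * F.
  rewrite -(@ler_pM2l _ (k ^+ 2)) ?exprn_gt0 //; apply: le_trans FkF _.
  have -> : k ^+ 2 * (p ^+ 2 * F) = (p * k) ^+ 2 * F by ring.
  by rewrite pk.
have h7 : h ^+ 2 * (r ^+ 2 * Fk) <= h ^+ 2 * (r ^+ 2 * (p ^+ 2 * F)).
  by do 2 (apply: ler_wpM2l; first exact: sqr_ge0).
apply: le_trans h7 _.
have -> : h ^+ 2 * (r ^+ 2 * (p ^+ 2 * F)) = h ^+ 2 * (r ^+ 2 * F) +
  F * (r ^+ 2 * (h ^+ 2 * (p ^+ 2 - 1))) by ring.
by rewrite lerD2l ler_wpM2l.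
Qed.

(** The first summand comes from the quadratic inequality at the maximum, the second from the case
    of a small cutoff. The final 1 makes the constant at least 1, so that its square dominates
    it. *)
Definition gradient_const : R :=
  4 * E ^+ 2 * (2 * cutoff_lap_const + 8 * E * cutoff_lip_const ^+ 2 +
    6 * (E + 1) * E * cutoff_lip_const) + 8 * cutoff_lip_const ^+ 2 * E + 1.

Lemma gradient_const_gt0 : 0 < gradient_const.
Proof.
rewrite /gradient_const.
have := cutoff_lip_const_ge0; have := cutoff_lap_const_ge0.
move: cutoff_lip_const cutoff_lap_const => B Q Q0 B0.
by apply: ltr_wpDl => //; rewrite !(addr_ge0, mulr_ge0, exprn_ge0).
Qed.

(** If the cutoff at [x] is O(1 / rho), the crude bound [defect_le] suffices. Otherwise it is
    positive at all neighbours, and maximality turns the Bochner inequality into a quadratic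
    inequality for the square root of the left side. *)
Lemma defect_at_max g rho x : 1 <= rho -> 0 < cutoff rho x ->
  0 < g x -> sqr_harmonic g x ->
  (forall s, s \in S -> 0 < g (x + s)) ->
  (forall s, s \in S -> sqr_harmonic g (x + s)) ->
  (forall s, s \in S -> 0 < cutoff rho (x + s) ->
     cutoff rho (x + s) ^+ 2 * defect g (x + s) <=
     cutoff rho x ^+ 2 * defect g x) ->
  2 * (cutoff rho x ^+ 2 * defect g x) <= (gradient_const / rho) ^+ 2.
Proof.
move=> rho1 cx gx hx gxs hxs xmax.
have D0 : 0 <= D by [].
set F := defect g x; set h := cutoff rho x; have h0 : 0 < h := cx.
have F0 : 0 <= F := defect_ge0 gx hx.
have h1 : h <= 1 := cutoff_le1 rho x.
have rho0 : 0 < rho by lra.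
set B := cutoff_lip_const; set Q := cutoff_lap_const; set Z := gradient_const.
have B0 : 0 <= B := cutoff_lip_const_ge0.
have Q0 : 0 <= Q := cutoff_lap_const_ge0.
have E0 : 0 <= E by lra.
have E10 : 0 <= E + 1 by lra.
have EB0 : 0 <= E * B ^+ 2 by rewrite mulr_ge0 ?sqr_ge0.
have EEB0 : 0 <= (E + 1) * E * B by rewrite !mulr_ge0.
have Zge : 8 * B ^+ 2 * E + 1 <= Z.
  rewrite /Z /gradient_const lerD2r lerDr -/B -/Q.
  by apply: mulr_ge0; [have := sqr_ge0 E|]; lra.
have Z1 : 1 <= Z by lra.
(* Above this threshold one step changes the cutoff by at most half its value, as [cutoff_ratio]
   requires. *)
have [hsmall|hbig] := ltrP h (2 * (B / rho)).
  have : h ^+ 2 * F <= (2 * (B / rho)) ^+ 2 * E.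
    apply: ler_pM => //; first exact: sqr_ge0.
      by rewrite ler_sqr ?nnegrE ?(ltW hsmall) ?(ltW cx) //; lra.
    by apply: le_trans (defect_le gx gxs) _; lra.
  move=> hF; apply: (@le_trans _ _ ((8 * B ^+ 2 * E) / rho ^+ 2)).
    have -> : 8 * B ^+ 2 * E / rho ^+ 2 = 2 * ((2 * (B / rho)) ^+ 2 * E).
      by field; rewrite gt_eqF.
    by rewrite ler_pM2l.
  by rewrite expr_div_n ler_pM2r ?invr_gt0 ?exprn_gt0 //; nra.
set w := Num.sqrt (2 * F).
have w2 : w ^+ 2 = 2 * F by rewrite sqr_sqrtr // mulr_ge0.
have w0 : 0 <= w := sqrtr_ge0 _.
set z := w * h.
have z0 : 0 <= z by rewrite mulr_ge0 // ltW.
have z2 : 2 * (h ^+ 2 * F) = z ^+ 2 by rewrite /z exprMn w2; ring.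
rewrite z2.
have [F00|Fn0] := eqVneq F 0.
  by rewrite -z2 F00 mulr0 mulr0 sqr_ge0.
have Fpos : 0 < F by rewrite lt_def Fn0.
have bochner : D * F + F ^+ 2 / (2 * E ^+ 2) <=
    \sum_(t <- S) (g (x + t) / g x) ^+ 2 * defect g (x + t).
  rewrite -(@ler_pM2l _ (g x ^+ 2)) ?exprn_gt0 // mulrDr mulrCA.
  apply: le_trans (defect_bochner gx hx gxs hxs) _.
  rewrite mulr_sumr; apply: ler_sum => t _.
  by rewrite mulrA -exprMn mulrCA divff ?mulr1 // gt_eqF.
(* The first-order terms [2 * h * (h - k)] must be summed before being bounded: [cutoff_lap] gives
   order 1 / rho^2 for the sum, but each one is only O(1 / rho). *)
have step : h ^+ 2 * (\sum_(t <- S) (g (x + t) / g x) ^+ 2 * defect g (x + t)) <=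
    h ^+ 2 * (D * F) + F * (2 * h * (Q / rho ^+ 2) +
    D * (8 * (B / rho) ^+ 2 + 6 * (E + 1) * z * (B / rho))).
  have -> : h ^+ 2 * (D * F) + F * (2 * h * (Q / rho ^+ 2) +
      D * (8 * (B / rho) ^+ 2 + 6 * (E + 1) * z * (B / rho))) =
    \sum_(t <- S) (h ^+ 2 * ((g (x + t) / g x) ^+ 2 * F) +
      F * (2 * h * (h - cutoff rho (x + t)) + 8 * (B / rho) ^+ 2 +
           6 * (E + 1) * z * (B / rho))).
    rewrite big_split /= -!mulr_sumr -mulr_suml sqr_harmonic_ratio //.
    congr (_ + _ * _); rewrite -sum_cst -(cutoff_lap rho x) mulr_sumr -big_split /=.
    by apply: eq_bigr => t _; rewrite -/h; ring.
  rewrite mulr_sumr !big_seq; apply: ler_sum => t tS.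
  have lip := cutoff_lip rho1 cx tS.
  apply: cutoff_ratio => //.
  - by apply: divr_gt0 => //; apply: gxs.
  - exact: sqr_harmonic_ratio_le.
  - by rewrite w2; apply: ratio_sub1_le.
  - apply: xmax => //; have := ler_norm (cutoff rho x - cutoff rho (x + t)).
    by rewrite -/h -/B in lip hbig *; have := cx; rewrite -/h; lra.
(* The terms [D * F] cancel between [bochner] and [step], and a factor [F] divides out. *)
have main : z ^+ 2 / (4 * E ^+ 2) <= 2 * h * (Q / rho ^+ 2) +
    D * (8 * (B / rho) ^+ 2 + 6 * (E + 1) * z * (B / rho)).
  rewrite -(ler_pM2l Fpos).
  have -> : F * (z ^+ 2 / (4 * E ^+ 2)) = h ^+ 2 * (F ^+ 2 / (2 * E ^+ 2)).
    by rewrite -z2; field; rewrite gt_eqF //; lra.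
  have : h ^+ 2 * (D * F + F ^+ 2 / (2 * E ^+ 2)) <=
      h ^+ 2 * (\sum_(t <- S) (g (x + t) / g x) ^+ 2 * defect g (x + t)).
    by apply: ler_wpM2l; rewrite ?sqr_ge0.
  by move: step; rewrite mulrDr; lra.
(* This rescaling removes [rho] from the quadratic inequality. *)
set Y := z * rho.
have zY : z = Y / rho by rewrite mulfK ?gt_eqF.
have Y0 : 0 <= Y by rewrite mulr_ge0 // ltW.
rewrite zY ler_sqr ?nnegrE ?divr_ge0 ?(ltW rho0) //; last by lra.
rewrite ler_pM2r ?invr_gt0 //.
have mainY : Y ^+ 2 <= 4 * E ^+ 2 * (2 * Q + 8 * E * B ^+ 2 + 6 * (E + 1) * E * B * Y).
  move: main; rewrite ler_pdivrMr; last by have := sqr_ge0 E; nra.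
  rewrite zY -(@ler_pM2r _ (rho ^+ 2)) ?exprn_gt0 //.
  have -> : (Y / rho) ^+ 2 * rho ^+ 2 = Y ^+ 2 by field; rewrite gt_eqF.
  move/le_trans; apply.
  have -> : (2 * h * (Q / rho ^+ 2) + D * (8 * (B / rho) ^+ 2 +
      6 * (E + 1) * (Y / rho) * (B / rho))) * (4 * E ^+ 2) * rho ^+ 2 =
    4 * E ^+ 2 * (2 * (h * Q) + D * (8 * B ^+ 2 + 6 * (E + 1) * (B * Y))).
    by field; rewrite gt_eqF.
  apply: ler_wpM2l; first by have := sqr_ge0 E; lra.
  have BY : 0 <= B * Y by apply: mulr_ge0.
  have hQ : h * Q <= Q by rewrite ler_piMl.
  have := sqr_ge0 B; nra.
have [//|YZ] := lerP Y Z.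
(* As [Y >= 1], the constant terms of [mainY] may be multiplied by [Y]; cancelling [Y] then
   contradicts [Z < Y]. *)
have Y1 : 1 <= Y by lra.
have : Y * Y <= 4 * E ^+ 2 * (2 * Q + 8 * E * B ^+ 2 + 6 * (E + 1) * E * B) * Y.
  rewrite -expr2; apply: le_trans mainY _; rewrite -[leRHS]mulrA; apply: ler_wpM2l.
    by have := sqr_ge0 E; lra.
  rewrite [leRHS]mulrDl lerD2r ler_peMr //.
  by move: EB0; rewrite -mulrA; lra.
rewrite ler_pM2r; last by lra.
by move: YZ EB0; rewrite /Z /gradient_const -/B -/Q; lra.
Qed.

End Cutoff.
End GradientEstimate.

Lemma seq_argmax (R : realType) (T : choiceType) (L : seq T) (P : pred T)
    (h : T -> R) (x0 : T) : x0 \in L -> P x0 ->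
  exists2 x, P x & forall y, y \in L -> P y -> h y <= h x.
Proof.
move=> x0L Px0.
have [x Px xmax] := @arg_maxP _ R (seq_sub L) (SeqSub x0L)
  (fun z => P (val z)) (fun z => h (val z)) Px0.
by exists (val x) => // y yL Py; apply: (xmax (SeqSub yL)).
Qed.

(** * Word lengths in the generators *)

Section Words.
Variables (G : zmodType) (S : seq G).

(** The word-metric ball of radius [n] around 0, without the extended-real infimum; [word_dist_le]
    makes the link. *)
Definition word (n : nat) (y : G) : Prop :=
  exists p : seq G, [/\ {subset p <= S}, (size p <= n)%N & y = \sum_(s <- p) s].

Lemma word0 n : word n 0.
Proof. by exists [::]; rewrite big_nil. Qed.

Lemma word_gen s : s \in S -> word 1 s.
Proof.
by move=> sS; exists [:: s]; rewrite big_seq1; split=> // t; rewrite inE => /eqP ->.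
Qed.

Lemma wordD n k y z : word n y -> word k z -> word (n + k)%N (y + z).
Proof.
move=> [p [pS pn ->]] [q [qS qk ->]]; exists (p ++ q).
rewrite big_cat size_cat leq_add //; split=> // t.
by rewrite mem_cat => /orP[/pS|/qS].
Qed.

Lemma word_le n k y : (n <= k)%N -> word n y -> word k y.
Proof. by move=> nk [p [pS pn ->]]; exists p; rewrite (leq_trans pn). Qed.

Lemma word_sum (I : Type) (r : seq I) (n : I -> nat) (y : I -> G) :
  (forall i, word (n i) (y i)) ->
  word (\sum_(i <- r) n i)%N (\sum_(i <- r) y i).
Proof.
move=> ny; elim: r => [|i r IH]; first by rewrite !big_nil; apply: word0.
by rewrite !big_cons; apply: wordD.
Qed.

Lemma word_enum n : exists L : seq G, forall y, word n y -> y \in L.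
Proof.
elim: n => [|n [L LP]].
  exists [:: 0] => y [[|s p] [_ //]].
  by rewrite big_nil inE => _ ->.
exists (0 :: [seq s + y | s <- S, y <- L]) => y [[|s p] [pS pn ->]].
  by rewrite big_nil mem_head.
rewrite big_cons inE; apply/orP; right; apply: allpairs_f.
  by apply: pS; rewrite mem_head.
by apply: LP; exists p; split=> // t tp; apply: pS; rewrite inE tp orbT.
Qed.

Lemma word_dist_le (R : realType) n x y : word n y ->
  (word_dist R S x (x + y) <= n%:R%:E)%E.
Proof.
move=> [p [pS pn ->]]; apply: (@le_trans _ _ (size p)%:R%:E).
  apply: ereal_inf_lbound; exists (scanl +%R x p); last by rewrite size_scanl.
  elim: p x pS {pn} => [|s p IH] x pS /=; first by rewrite big_nil addr0.
  have [|h1 h2] := IH (x + s); first by move=> t tp; apply: pS; rewrite inE tp orbT.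
  split; last by rewrite h2 big_cons addrA.
  by rewrite h1 andbT /cayley_adj addrAC subrr add0r pS // mem_head.
by rewrite lee_fin ler_nat.
Qed.

Hypothesis S_sym : perm_eq [seq - s | s <- S] S.

Lemma wordN n y : word n y -> word n (- y).
Proof.
move=> [p [pS pn ->]]; exists [seq - s | s <- p].
rewrite size_map big_map sumrN; split=> // t /mapP[s sp ->].
by rewrite -(perm_mem S_sym) map_f // pS.
Qed.

Lemma word_intmul n y (z : int) : word n y -> word (n * `|z|)%N (y *~ z).
Proof.
move=> ny.
have word_natmul k : word (n * k)%N (y *+ k).
  by elim: k => [|k IH]; [rewrite muln0; apply: word0|rewrite mulnS mulrS; apply: wordD].
by case: z => k; [apply: word_natmul|apply: wordN; apply: word_natmul].
Qed.

(** The elements expressible by words form a subgroup containing [S]. *)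
Lemma generates_word : generates S -> forall y, exists n, word n y.
Proof.
move=> Sgen y; pose H : {pred G} := [pred y | `[< exists n, word n y >]].
suff HT : H =i predT by have := HT y; rewrite !inE => /asboolP.
apply: Sgen => [|s sS]; last by apply/asboolP; exists 1%N; apply: word_gen.
split; first by apply/asboolP; exists 0%N; apply: word0.
move=> u v /asboolP[n nu] /asboolP[k kv]; apply/asboolP.
by exists (n + k)%N; apply: wordD => //; apply: wordN.
Qed.

(** An element is a torsion part plus integer multiples of the [m] basis vectors. There are finitely
    many torsion parts, so one [N] bounds their word lengths and those of the basis vectors; the
    summand 1 accounts for the torsion part. *)
Lemma word_bound_model (m l : nat) (q : 'I_l -> nat)
    (phi : {additive G -> fg_abelian_model m q}) :
  bijective phi -> generates S ->
  exists N, forall y, word (N * (1 + \sum_i `|(phi y).1 ord0 i|))%N y.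
Proof.
move=> phi_bij Sgen; have [psi phiK psiK] := phi_bij.
have [len lenP] := choice (generates_word Sgen).
pose e i := psi (delta_mx 0 i, 0).
pose tors t := psi (0, t).
(* The sums serve as upper bounds for each of their terms. *)
exists (\sum_i len (e i) + \sum_t len (tors t))%N => y.
set N := (_ + _)%N.
have wordE i : word N (e i).
  by apply: word_le (lenP _); rewrite /N (bigD1 i) //= -addnA leq_addr.
have wordT : word N (tors (phi y).2).
  by apply: word_le (lenP _); rewrite /N addnC (bigD1 (phi y).2) //= -addnA leq_addr.
have yE : y = tors (phi y).2 + \sum_i e i *~ (phi y).1 ord0 i.
  apply: (bij_inj phi_bij); rewrite raddfD raddf_sum psiK.
  under eq_bigr do rewrite raddfMz psiK.
  apply/eqP; rewrite -pair_eqE /=; apply/andP; split; apply/eqP.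
    rewrite [RHS]add0r (raddf_sum fst) [LHS]row_sum_delta.
    apply: eq_bigr => i _; rewrite (raddfMz fst) /=.
    by rewrite -scaler_int intz.
  rewrite (raddf_sum snd) big1 ?addr0 // => i _.
  by rewrite (raddfMz snd) /= mul0rz.
rewrite [X in word _ X]yE mulnDr muln1 big_distrr /=; apply: wordD => //.
by apply: word_sum => i; apply: word_intmul.
Qed.

End Words.

(** * Return from the square root to [f], and the theorem *)

Section Conclusion.
Variables (R : realType) (G : zmodType) (S : seq G).
Hypothesis S_sym : perm_eq [seq - s | s <- S] S.
Local Notation E := ((size S)%:R + 1 : R).

Lemma sqr_harmonic_sqrt (f : G -> R) x :
  0 < f x -> (forall s, s \in S -> 0 < f (x + s)) -> laplacian S f x = 0 ->
  sqr_harmonic S (fun y => Num.sqrt (f y)) x.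
Proof.
move=> fx fxs; rewrite /laplacian sumrB sum_cst => /eqP.
rewrite subr_eq0 /sqr_harmonic sqr_sqrtr ?ltW // => /eqP <-.
rewrite !big_seq; apply: eq_bigr => s sS.
by rewrite sqr_sqrtr // ltW // fxs.
Qed.

(** With r the ratio of square roots, f (x + s) - f x = f x (r + 1) (r - 1). Here r + 1 is at most
    [E + 1], and the (r - 1)^2 sum to twice the defect. *)
Lemma grad_norm_le_defect (f : G -> R) x (w : R) :
  0 < f x -> (forall s, s \in S -> 0 < f (x + s)) -> laplacian S f x = 0 ->
  0 <= w -> 2 * defect S (fun y => Num.sqrt (f y)) x <= w ^+ 2 ->
  grad_norm S f x <= (E + 1) * w * f x.
Proof.
move=> fx fxs lapf w0 Fw; have D0 : 0 <= (size S)%:R :> R by [].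
have hx := sqr_harmonic_sqrt fx fxs lapf.
have gx : 0 < Num.sqrt (f x) by rewrite sqrtr_gt0.
set g := fun y => Num.sqrt (f y) in hx Fw.
have fx0 := ltW fx; have E10 : 0 <= E + 1 by lra.
rewrite -[leRHS]ger0_norm; last by rewrite !mulr_ge0.
rewrite -sqrtr_sqr ler_sqrt ?sqr_ge0 //.
apply: (@le_trans _ _ (\sum_(s <- S)
    ((E + 1) * f x) ^+ 2 * (g (x + s) / g x - 1) ^+ 2)).
  rewrite !big_seq; apply: ler_sum => s sS.
  have rE := sqr_harmonic_ratio_le (gx : 0 < g x) hx sS.
  set r := g (x + s) / g x in rE *.
  have r0 : 0 <= r by rewrite divr_ge0 // sqrtr_ge0.
  have -> : f (x + s) = f x * r ^+ 2.
    rewrite /r expr_div_n !sqr_sqrtr ?ltW ?fxs //.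
    by rewrite mulrC divfK // gt_eqF.
  have -> : (f x * r ^+ 2 - f x) ^+ 2 = ((r + 1) * f x) ^+ 2 * (r - 1) ^+ 2 by ring.
  apply: ler_wpM2r; first exact: sqr_ge0.
  have r10 : 0 <= r + 1 by lra.
  by rewrite ler_sqr ?nnegrE ?mulr_ge0 // ler_pM2r //; lra.
rewrite -mulr_sumr sqr_harmonic_energy //.
have -> : ((E + 1) * w * f x) ^+ 2 = ((E + 1) * f x) ^+ 2 * w ^+ 2 by ring.
by apply: ler_wpM2l => //; apply: sqr_ge0.
Qed.

(** The cutoff is 1 at 0, so the maximum of cutoff^2 times defect bounds the defect there. Two
    further steps [s], [t] occur because harmonicity of the square at neighbours of the maximum
    point involves their own neighbours. *)
Lemma gradient_estimate_cutoff (m : nat) (pi : 'I_m -> G -> R)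
    (piD : forall i, {morph pi i : x y / x + y}) (rho : R) (L : seq G)
    (f : G -> R) : 1 <= rho ->
  (forall y, 0 < cutoff pi rho y -> y \in L) ->
  (forall y s t, 0 < cutoff pi rho y -> s \in 0 :: S -> t \in 0 :: S ->
     0 < f (y + s + t) /\ laplacian S f (y + s + t) = 0) ->
  grad_norm S f 0 <= (E + 1) * gradient_const S pi / rho * f 0.
Proof.
move=> rho1 cL Hf.
have pi0 i : pi i 0 = 0 by apply: (addrI (pi i 0)); rewrite -piD !addr0.
have c0 : cutoff pi rho 0 = 1.
  by rewrite /cutoff big1 ?mul0r ?subr0 // => i _; rewrite pi0 expr0n.
have zS : 0 \in 0 :: S by rewrite mem_head.
have SS s : s \in S -> s \in 0 :: S by rewrite inE orbC => ->.
have f0 y : 0 < cutoff pi rho y -> 0 < f y /\ laplacian S f y = 0.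
  by move=> cy; have := Hf y 0 0 cy zS zS; rewrite !addr0.
have f1 y s : 0 < cutoff pi rho y -> s \in S ->
    0 < f (y + s) /\ laplacian S f (y + s) = 0.
  by move=> cy sS; have := Hf y s 0 cy (SS _ sS) zS; rewrite !addr0.
have c0pos : 0 < cutoff pi rho 0 by rewrite c0.
pose g y := Num.sqrt (f y).
have [x cx xmax] := @seq_argmax R G L (fun y => 0 < cutoff pi rho y)
  (fun y => cutoff pi rho y ^+ 2 * defect S g y) 0 (cL _ c0pos) c0pos.
have Z0 := ltW (gradient_const_gt0 S pi).
have : 2 * (cutoff pi rho x ^+ 2 * defect S g x) <= (gradient_const S pi / rho) ^+ 2.
  apply: defect_at_max => //.
  - by rewrite sqrtr_gt0; have [] := f0 _ cx.
  - have [fx lx] := f0 _ cx; apply: sqr_harmonic_sqrt => // s sS.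
    by have [] := f1 _ _ cx sS.
  - by move=> s sS; rewrite sqrtr_gt0; have [] := f1 _ _ cx sS.
  - move=> s sS; have [fx lx] := f1 _ _ cx sS; apply: sqr_harmonic_sqrt => // t tS.
    by have [] := Hf x s t cx (SS _ sS) (SS _ tS).
  - by move=> s sS cxs; apply: xmax => //; apply: cL.
move=> Fx; rewrite -[_ * _ / rho]mulrA.
have [f00 l00] := f0 _ c0pos.
apply: grad_norm_le_defect => //.
- by move=> s sS; have [] := f1 _ _ c0pos sS.
- by rewrite divr_ge0 //; lra.
- apply: le_trans Fx; rewrite ler_pM2l //.
  by have := xmax _ (cL _ c0pos) c0pos; rewrite c0 expr1n mul1r.
Qed.

End Conclusion.

(** Negation exchanges the two halves of the list, so multiplicities agree. *)
Lemma symmetric_generating_list_perm (G : zmodType) (r : nat)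
    (S : (r + r).-tuple G) :
  symmetric_generating_list S -> perm_eq [seq - s | s <- S] S.
Proof.
move=> [Ssym _]; apply/permP => a.
rewrite count_map -!sum1_count [LHS]big_mkcond [RHS]big_mkcond !big_tuple /=.
rewrite !big_split_ord /= addnC.
by congr addn; apply: eq_bigr => i _; rewrite Ssym ?opprK.
Qed.

Theorem theorem1p1 (R : realType) (m : nat) (m_ge1 : (1 <= m)%N)
  (G : zmodType) (r : nat) (S : (r + r).-tuple G)
  (S_gen : symmetric_generating_list S) :
  exists C1 C2 : R, 0 < C1 /\ 0 < C2 /\
  forall (l : nat) (p a : 'I_l -> nat),
    (forall i, prime (p i)) -> (forall i, (1 <= a i)%N) ->
    zmod_isom G (fg_abelian_model m (fun i => (p i ^ a i)%N)) ->
  forall (x : G) (rho : R), 1 <= rho ->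
  forall f : G -> R,
    (forall y, vertex_closure R S (word_ball S x (C1 * rho)) y -> 0 < f y) ->
    harmonic_on S f (word_ball S x (C1 * rho)) ->
  grad_norm S f x <= C2 / rho * f x.
Proof.
have S_sym := symmetric_generating_list_perm S_gen.
(* The constants precede [l], [p] and [a], so one isomorphism is chosen now to build them; if none
   exists, the estimate is vacuous. *)
have [[l [q [phi phi_bij]]]|no_model] := pselect (exists l (q : 'I_l -> nat),
    zmod_isom G (fg_abelian_model m q)); last first.
  exists 1, 1; do 2!split=> //; move=> l p a _ _ iso.
  by case: no_model; exists l, (fun i => (p i ^ a i)%N).
have [N wordN] := word_bound_model S_sym phi_bij S_gen.2.
pose pi (i : 'I_m) (y : G) : R := ((phi y).1 ord0 i)%:~R.
have piD i : {morph pi i : x y / x + y}.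
  by move=> y z; rewrite /pi raddfD mxE intrD.
have N0 : 0 <= N%:R :> R by [].
have m0 : 0 <= m%:R :> R by [].
(* Where the cutoff is positive, word length is at most N (1 + m rho), hence at most N (1 + m) rho;
   the 2 pays for the steps [s] and [t]. *)
pose C1 : R := N%:R * (1 + m%:R) + 2.
pose D : R := (size S)%:R.
have D0 : 0 <= D by [].
pose C2 : R := (D + 1 + 1) * gradient_const S pi.
have C10 : 0 < C1 by rewrite /C1; nra.
have C20 : 0 < C2.
  by apply: mulr_gt0; [lra|apply: gradient_const_gt0].
exists C1, C2; do 2!split=> //.
move=> _ _ _ _ _ _ x rho rho1 f fpos fharm.
have rho0 : 0 < rho by lra.
have wordR y : 0 < cutoff pi rho y ->
    exists2 n, word S n y & n%:R + 2 <= C1 * rho.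
  move=> cy; eexists; first exact: wordN.
  have sumle : (\sum_i `|(phi y).1 ord0 i|)%:R <= m%:R * rho.
    rewrite natr_sum -[m in m%:R]card_ord -sumr_const mulr_suml.
    apply: ler_sum => i _; rewrite mul1r natr_absz intr_norm.
    exact: (@cutoff_gt0_coord R G m pi rho y i rho0 cy).
  rewrite natrM natrD /C1.
  have : N%:R * (1 + (\sum_i `|(phi y).1 ord0 i|)%:R) <= N%:R * (1 + m%:R * rho) :> R.
    by apply: ler_wpM2l => //; lra.
  have : 0 <= N%:R * (rho - 1) by apply: mulr_ge0 => //; lra.
  lra.
have [L LP] := word_enum S (Num.truncn (C1 * rho)).+1.
have ball z n : word S n z -> n%:R <= C1 * rho -> word_ball S x (C1 * rho) (x + z).
  move=> nz nC; apply: le_trans (word_dist_le R x nz) _.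
  by rewrite lee_fin.
(* Translation moves [x] to 0, where the cutoff is centred. *)
have grad0 : grad_norm S (fun y => f (x + y)) 0 <= C2 / rho * f (x + 0).
  apply: (gradient_estimate_cutoff S_sym piD (L := L)) => //.
    move=> y /wordR[n ny nC]; apply: LP; apply: word_le ny.
    rewrite -(ler_nat R); apply: (@le_trans _ _ (C1 * rho)); first by lra.
    by apply: ltW; apply: truncnS_gt.
  move=> y s t /wordR[n ny nC] sS tS.
  have word1 u : u \in 0 :: S -> word S 1 u.
    by rewrite inE => /predU1P[->|/word_gen//]; apply: word0.
  have bz : word_ball S x (C1 * rho) (x + (y + s + t)).
    apply: ball (wordD (wordD ny (word1 _ sS)) (word1 _ tS)) _.
    by rewrite !natrD; lra.
  split; first by apply: fpos; left.
  by rewrite -[RHS](fharm _ bz); apply: eq_bigr => u _; rewrite addrA.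
rewrite addr0 in grad0; apply: le_trans grad0.
by rewrite /grad_norm ler_sqrt ?sumr_ge0 // => [|s _]; rewrite ?sqr_ge0 //;
  apply: ler_sum => s _; rewrite add0r addr0.
Qed.
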